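(* Let $0<m\le L$, $\kappa=L/m$, $1\le c<2$, $\underline{\alpha}=\frac{1}{cL}$ and $\overline{\alpha}=\frac{c}{L}$. Consider the problem of minimizing $\rho^2$ over scalars $\rho\in[0,1]$, positive definite matrices $P\in\mathbb{R}^{n\times n}$ and scalars $\lambda\ge 0$, subject to the constraint that the linear matrix inequality $$\begin{bmatrix} (1-\rho^2)P & -\alpha P\\ -\alpha P & \alpha^2P\end{bmatrix}+\lambda\begin{bmatrix} -2mL\,I_n & (L+m)I_n\\ (L+m)I_n & -2I_n\end{bmatrix}\preceq 0$$ holds for $\alpha=\underline{\alpha}$ and for $\alpha=\overline{\alpha}$. The best upper bound on the convergence rate of gradient descent with varying step sizes $\alpha_k\in[\underline{\alpha},\overline{\alpha}]$ based on the solution of this problem, i.e. the minimal value of $\rho$, is $$\rho_{\mathrm{varying}}=\begin{cases} c-1, & \kappa\le\frac{1}{c(2-c)},\\[2pt] 1-\frac{1}{c\kappa}, & \kappa>\frac{1}{c(2-c)}.\end{cases}$$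
   Context: $I_n$ is the $n\times n$ identity matrix and $\preceq 0$ means negative semidefinite. The setting is gradient descent $x_{k+1}=x_k-\alpha_k\nabla f(x_k)$ on $\mathbb{R}^n$ with step sizes $\alpha_k\in[\underline{\alpha},\overline{\alpha}]$, for $f:\mathbb{R}^n\to\mathbb{R}$ that is $m$-strongly convex with $L$-Lipschitz gradient and minimizer at the origin; $\kappa=L/m$ is the condition number. A convergence rate $\rho$ means that there is a constant $\beta>0$ with $\|x_k\|\le\beta\rho^k\|x_0\|$ for all $x_0\in\mathbb{R}^n$ and all integers $k\ge 0$. The linear matrix inequality is the paper's condition $$\begin{bmatrix} A^TPA-\rho^2P & A^TPB_u(\alpha)\\ B_u^T(\alpha)PA & B_u^T(\alpha)PB_u(\alpha)\end{bmatrix}+\lambda\begin{bmatrix} C_y&0\\0&I_n\end{bmatrix}^TM\begin{bmatrix} C_y&0\\0&I_n\end{bmatrix}\preceq 0$$ for certifying a convergence rate, with $A=C_y=I_n$, $B_u(\alpha)=-\alpha I_n$ and $M=\begin{bmatrix}-2mL&L+m\\L+m&-2\end{bmatrix}\otimes I_n$, the matrix of the sector constraint satisfied by $\nabla f$.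
   Formalization: Each of the two step sizes gets its own multiplier λ (P is shared), since with one common λ the formula fails (n=1, m=3/4, L=1, c=3/2); the minimal value is an infimum, attained if m<L or c=1, since for m=L, c>1 no minimum exists; n≥1 is assumed. *)

(* Defs.v *)
(* World: MathComp with MathComp-Analysis. *)
From mathcomp Require Import all_boot all_order all_algebra.
From mathcomp Require Import all_classical all_reals all_analysis.

Set Implicit Arguments.
Unset Strict Implicit.
Unset Printing Implicit Defensive.

Import Order.TTheory GRing.Theory Num.Theory.
Import numFieldNormedType.Exports.

Local Open Scope classical_set_scope.
Local Open Scope ring_scope.

Definition positive_definite (R : realType) (n : nat) (P : 'M[R]_n) : Prop :=
  P^T = P /\ forall x : 'cV[R]_n, x != 0 -> 0 < (x^T *m P *m x) 0 0.

Definition negative_semidefinite (R : realType) (n : nat) (Q : 'M[R]_n) : Prop :=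
  Q^T = Q /\ forall x : 'cV[R]_n, (x^T *m Q *m x) 0 0 <= 0.

(* The general rate LMI with A = C_y = I, B_u(alpha) = - alpha I and the sector
   matrix M = [-2mL, L+m; L+m, -2] (x) I_n, multiplied out. *)
Definition rate_lmi (R : realType) (n : nat) (m L alpha rho : R)
    (P : 'M[R]_n) (lam : R) : Prop :=
  negative_semidefinite
    (block_mx ((1 - rho ^+ 2) *: P) (- alpha *: P)
              (- alpha *: P) (alpha ^+ 2 *: P)
     + lam *: block_mx (- (2 * m * L))%:M (L + m)%:M
                       (L + m)%:M (- 2)%:M).

(* P is shared by the two step sizes, while each LMI carries its own
   multiplier.  Since the LMI is, after a Schur complement, jointly affine in
   (alpha, lam), such a pair of multipliers certifies the rate for all step
   sizes in between.  Forcing lam_lo = lam_hi gives a different optimal value: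
   for n = 1, m = 3/4, L = 1, c = 3/2, rho = 1/2 and P = 1, the LMI at
   1/(cL) = 2/3 holds only for lam = 4/3, the one at c/L = 3/2 only for
   lam = 3. *)
Definition feasible_rate (R : realType) (n : nat) (m L alpha_lo alpha_hi : R)
    (rho : R) : Prop :=
  0 <= rho <= 1 /\
  exists (P : 'M[R]_n) (lam_lo lam_hi : R),
    [/\ positive_definite P, 0 <= lam_lo, 0 <= lam_hi,
        rate_lmi m L alpha_lo rho P lam_lo &
        rate_lmi m L alpha_hi rho P lam_hi].

(* The optimal value is an infimum: for m = L and 1 < c the rate c - 1 is
   approached but not attained, because along (1, L) the quadratic form of the
   LMI at c/L vanishes for every multiplier without being stationary. *)
Definition optimal_rate (R : realType) (n : nat) (m L alpha_lo alpha_hi : R)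
    (rho : R) : Prop :=
  let feasible := [set r : R | feasible_rate n m L alpha_lo alpha_hi r] in
  [/\ 0 <= rho, feasible !=set0 &
      inf [set r ^+ 2 | r in feasible] = rho ^+ 2].

(* The norm [`|x|] of MathComp-Analysis on matrices is the sup norm. *)
Definition enorm (R : realType) (n : nat) (x : 'cV[R]_n) : R :=
  Num.sqrt (\sum_i x i 0 ^+ 2).

Definition grad (R : realType) (n : nat) (f : 'cV[R]_n -> R) (x : 'cV[R]_n) :
    'cV[R]_n :=
  \col_i 'D_(delta_mx i 0) f x.

Definition strongly_convex (R : realType) (n : nat) (m : R)
    (f : 'cV[R]_n -> R) : Prop :=
  convex_function [set: 'cV[R]_n] (fun x => f x - m / 2 * enorm x ^+ 2).

Definition lipschitz_gradient (R : realType) (n : nat) (L : R)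
    (f : 'cV[R]_n -> R) : Prop :=
  (forall x, differentiable f x) /\
  forall x y, enorm (grad f x - grad f y) <= L * enorm (x - y).

(* [beta] may depend on [f] but not on the trajectory, so the step sizes may
   be chosen adaptively, e.g. by a line search started at [x 0]. *)
Definition gd_convergence_rate (R : realType) (n : nat) (f : 'cV[R]_n -> R)
    (alpha_lo alpha_hi rho : R) : Prop :=
  exists2 beta : R, 0 < beta &
    forall (alpha : nat -> R) (x : nat -> 'cV[R]_n),
      (forall k, alpha_lo <= alpha k <= alpha_hi) ->
      (forall k, x k.+1 = x k - alpha k *: grad f (x k)) ->
      forall k, enorm (x k) <= beta * rho ^+ k * enorm (x 0).

Definition rho_varying (R : realType) (kappa c : R) : R :=
  if kappa <= (c * (2 - c))^-1 then c - 1 else 1 - (c * kappa)^-1.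

(* Main.v *)
Require Import Defs.
From mathcomp Require Import all_boot all_order all_algebra.
From mathcomp Require Import all_classical all_reals all_analysis.
From mathcomp Require Import ring lra.

Set Implicit Arguments.
Unset Strict Implicit.
Unset Printing Implicit Defensive.

Import Order.TTheory GRing.Theory Num.Theory.
Import numFieldNormedType.Exports.

Local Open Scope classical_set_scope.
Local Open Scope ring_scope.

(** On the eigenvector of a quadratic with curvature s in [m, L], a gradient
    step of length a multiplies the iterate by 1 - a s.  Over all s in [m, L]
    and all admissible a, the largest value of |1 - a s| is reached either at
    s = L with the longest step, where it is c - 1, or at s = m with the
    shortest step, where it is 1 - m / (c L).  The stated rate is the larger of
    these two numbers ([rho_varying_max], [rho_varying_slope]).

    No smaller rate is feasible: on a vector (x, s x) with m <= s <= L the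
    sector term of the LMI is nonnegative, so the LMI forces |1 - a s| <= rho
    whatever P and lambda are ([rate_lmi_slope_le]).

    Conversely P = I suffices.  Then the LMI splits into n copies of one scalar
    inequality in (x, g), called [sector_certificate] below, and for m < L a
    multiplier making the left-hand side minus a multiple of a single square is
    obtained by requiring tangency at the slope s in {m, L} where |1 - a s| is
    largest ([sector_certificate_sharp]).  When m = L the sector term is itself
    minus a square, and every rate strictly above |1 - a L| is certified by a
    large multiplier ([sector_certificate_eq]); so the infimum is unchanged
    even though it need not be attained.

    For the actual iteration, the gradient of f satisfies the sector
    constraint (grad f x - m x) . (L x - grad f x) >= 0, which is the
    co-coercivity inequality [gradient_sector].  Adding it to the certificate
    gives |x - a grad f x| <= rho |x| for each admissible step
    ([gradient_step_contracts]), hence the geometric decay with beta = 1. *)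

(** * The Euclidean inner product *)

Section DotProduct.
Variables (R : realType) (n : nat).
Implicit Types (u v w : 'cV[R]_n) (a k : R).

Definition dot u v : R := \sum_i u i 0 * v i 0.

Lemma dotC u v : dot u v = dot v u.
Proof. by apply: eq_bigr => i _; rewrite mulrC. Qed.

Lemma dotDl u v w : dot (u + v) w = dot u w + dot v w.
Proof. by rewrite -big_split; apply: eq_bigr => i _; rewrite mxE mulrDl. Qed.

Lemma dotZl a u w : dot (a *: u) w = a * dot u w.
Proof. by rewrite mulr_sumr; apply: eq_bigr => i _; rewrite mxE mulrA. Qed.

Lemma dotNl u w : dot (- u) w = - dot u w.
Proof. by rewrite -scaleN1r dotZl mulN1r. Qed.

Lemma dotDr u v w : dot w (u + v) = dot w u + dot w v.
Proof. by rewrite !(dotC w) dotDl. Qed.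

Lemma dotZr a u w : dot w (a *: u) = a * dot w u.
Proof. by rewrite !(dotC w) dotZl. Qed.

Lemma dotNr u w : dot w (- u) = - dot w u.
Proof. by rewrite !(dotC w) dotNl. Qed.

Definition dotE := (dotDl, dotDr, dotNl, dotNr, dotZl, dotZr).

Lemma dot_ge0 u : 0 <= dot u u.
Proof. by apply: sumr_ge0 => i _; rewrite -expr2 sqr_ge0. Qed.

Lemma dot_eq0 u : dot u u = 0 -> u = 0.
Proof.
move=> u0; apply/matrixP => i j; rewrite ord1 mxE; apply/eqP.
rewrite -sqrf_eq0 expr2.
have /psumr_eq0P := u0; move=> /(_ _ i isT) -> // k _.
by rewrite -expr2 sqr_ge0.
Qed.

Lemma enorm_sqr u : enorm u ^+ 2 = dot u u.
Proof.
rewrite sqr_sqrtr; last by apply: sumr_ge0 => i _; rewrite sqr_ge0.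
by apply: eq_bigr => i _; rewrite expr2.
Qed.

Lemma enorm_ge0 u : 0 <= enorm u.
Proof. exact: sqrtr_ge0. Qed.

Lemma enorm_leE u v k : 0 <= k ->
  (enorm u <= k * enorm v) = (dot u u <= k ^+ 2 * dot v v).
Proof.
move=> k0; rewrite -!enorm_sqr -exprMn.
by rewrite ler_sqr // nnegrE ?mulr_ge0 // enorm_ge0.
Qed.

(** The only form of the Cauchy-Schwarz inequality that is used: it follows
    from expanding |u - k v|^2 >= 0. *)
Lemma dot_le_of_enorm_le u v k : 0 < k ->
  enorm u <= k * enorm v -> dot u v <= k * dot v v.
Proof.
move=> k0; rewrite enorm_leE; last exact: ltW.
move=> uv.
rewrite -(ler_pM2l k0).
have := dot_ge0 (u - k *: v); rewrite !dotE (dotC v u); nra.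
Qed.

End DotProduct.

(** * Gradients and the sector constraint *)

Section Gradient.
Variables (R : realType) (n : nat) (f : 'cV[R]_n -> R).
Implicit Types (x y v : 'cV[R]_n).

Lemma derive_grad x v : differentiable f x -> 'D_v f x = dot (grad f x) v.
Proof.
move=> df; rewrite deriveE //.
have -> : v = \sum_i v i 0 *: delta_mx i 0.
  by rewrite [LHS]matrix_sum_delta; apply: eq_bigr => i _; rewrite big_ord1.
rewrite linear_sum /= /dot; apply: eq_bigr => i _.
rewrite linearZ /= mxE deriveE // mulrC; congr (_ * _).
rewrite summxE (bigD1 i) //= !mxE !eqxx mulr1 big1 ?addr0 // => j ji.
by rewrite !mxE eq_sym (negbTE ji) mulr0.
Qed.

Lemma is_derive_line x v (t : R) : differentiable f (x + t *: v) ->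
  is_derive t 1 (fun s : R => f (x + s *: v)) (dot (grad f (x + t *: v)) v).
Proof.
move=> df; have dv : derivable f (x + t *: v) v by exact: diff_derivable.
have E : (fun h : R => h^-1 *: (((fun s : R => f (x + s *: v)) \o shift t) (h *: 1)
            - f (x + t *: v)))
       = (fun h : R => h^-1 *: ((f \o shift (x + t *: v)) (h *: v)
            - f (x + t *: v))).
  apply/funext => h /=; congr (_ *: (f _ - _)).
  by rewrite [h *: 1]mulr1 scalerDl addrCA.
by split; rewrite /derivable /derive E // -derive_grad.
Qed.

End Gradient.

Section SmoothConvex.
Variables (R : realType) (n : nat) (f : 'cV[R]_n -> R) (m L : R).
Implicit Types (x y v : 'cV[R]_n).

(** The descent lemma: along the segment, t |-> f (x + t v) minus its quadratic
    upper model has derivative (grad f (x + t v) - grad f x) . v - L t |v|^2,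
    which is nonpositive by the Lipschitz bound, so the mean value theorem
    applies. *)
Lemma descent_bound x v : 0 < L -> lipschitz_gradient L f ->
  f (x + v) <= f x + dot (grad f x) v + L / 2 * dot v v.
Proof.
move=> L0 [df lip].
pose p : R -> R := (fun t => f (x + t *: v)) - (dot (grad f x) v) *: (@id R)
                   - (L / 2 * dot v v) *: ((@id R) ^+ 2).
pose p' : R -> R := fun t =>
  dot (grad f (x + t *: v)) v - dot (grad f x) v - L * t * dot v v.
have dp (t : R) : is_derive t 1 p (p' t).
  have lin := is_derive_line (df (x + t *: v)).
  rewrite /p; apply: is_derive_eq.
  rewrite /p' /GRing.scale /= expr1; by field.
have [c c01 pE] : exists2 c, c \in `]0, 1[ & p 1 - p 0 = p' c * (1 - 0).
  apply: MVT; first exact: ltr01.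
  apply: continuous_subspaceT => t.
  by apply/differentiable_continuous/derivable1_diffP; have [] := dp t.
move: c01; rewrite in_itv /= => /andP[c0 _].
have : p' c <= 0.
  have := lip (x + c *: v) x; rewrite [x + _ - x]addrC addKr.
  have -> : enorm (c *: v) = c * enorm v.
    apply/eqP; rewrite -(@eqrXn2 _ 2) ?enorm_ge0 ?mulr_ge0 ?enorm_ge0 ?ltW //.
    by rewrite exprMn !enorm_sqr !dotE mulrA expr2.
  rewrite mulrA => /dot_le_of_enorm_le; rewrite mulr_gt0 // => /(_ isT).
  rewrite dotE dotNl /p'; lra.
move: pE; rewrite subr0 mulr1 => <-.
have -> : p 1 - p 0 = f (x + v) - dot (grad f x) v - L / 2 * dot v v - f x.
  have pE t : p t = f (x + t *: v) - dot (grad f x) v * t - L / 2 * dot v v * t ^+ 2.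
    by [].
  by rewrite !pE scale1r scale0r addr0; ring.
lra.
Qed.

(** Convexity of f - m/2 |.|^2 between x and x + v bounds the difference
    quotient of f at x by f (x + v) - f x - m/2 (1 - t) |v|^2; let t tend to
    0 from the right. *)
Lemma strongly_convex_above_tangent x v :
  differentiable f x -> strongly_convex m f ->
  f x + dot (grad f x) v + m / 2 * dot v v <= f (x + v).
Proof.
move=> df cf.
suff : dot (grad f x) v <= f (x + v) - f x - m / 2 * dot v v by lra.
rewrite -derive_grad //.
have key (t : R) : 0 < t -> t < 1 ->
  t^-1 *: ((f \o shift x) (t *: v) - f x)
    <= f (x + v) - f x - m / 2 * dot v v + t * (m / 2 * dot v v).
  move=> t0 t1.
  have := cf (Itv01 (ltW t0) (ltW t1)) (x + v) x.
  rewrite !inE => /(_ Logic.I Logic.I).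
  rewrite /conv /=.
  rewrite -[t^-1 *: _]/(t^-1 * _) ler_pdivrMl //.
  rewrite !enorm_sqr -[X in _ <= X -> _]/(t * (f (x + v) - m / 2 * dot (x + v) (x + v))
    + (1 - t) * (f x - m / 2 * dot x x)).
  rewrite /unstable.onem.
  have -> : t *: (x + v) + (1 - t) *: x = t *: v + x.
    rewrite scalerDr scalerBl scale1r.
    by rewrite [t *: x + _]addrC -addrA [X in _ + X = _]addrC subrK.
  rewrite !dotE (dotC v x); nra.
have dv : derivable f x v by exact: diff_derivable.
apply: (ler_cvg_to (cvg_dnbhs_at_right dv)
  (g := fun t : R => f (x + v) - f x - m / 2 * dot v v + t * (m / 2 * dot v v))).
  apply: cvg_at_right_filter.
  rewrite -[X in _ --> X]addr0 -[X in _ --> _ + X](mul0r (m / 2 * dot v v)).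
  by apply: cvgD; [exact: cvg_cst | apply: cvgM; [exact: cvg_id | exact: cvg_cst]].
near=> t.
by apply: key; near: t; [exact: nbhs_right_gt | exact: nbhs_right_lt].
Unshelve. all: by end_near. Qed.

(** Otherwise the descent lemma shows that the step of length 1/L from the
    minimizer strictly decreases f. *)
Lemma grad_minimizer y : 0 < L -> lipschitz_gradient L f ->
  (forall x, f y <= f x) -> grad f y = 0.
Proof.
move=> L0 lip miny; apply: dot_eq0.
have := descent_bound y (- L^-1 *: grad f y) L0 lip.
rewrite !dotE; move: (miny (y + - L^-1 *: grad f y)) (dot_ge0 (grad f y)).
set N := dot _ _; set fz := f _ => le_y N0 le_z.
have E : L / 2 * (- L^-1 * (- L^-1 * N)) = L^-1 * N / 2 by field; rewrite gt_eqF.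
rewrite E in le_z.
have : L^-1 * N <= 0 by lra.
by rewrite pmulr_rle0 ?invr_gt0 // => N0'; apply/eqP; rewrite eq_le N0' N0.
Qed.

(** Co-coercivity of the gradient of f - m/2 |.|^2, which is convex and
    (L - m)-smooth.  With h the increment of that gradient between y and x,
    the points y + t h and x - t h are compared with x and y, from below by
    strong convexity and from above by the descent lemma.  Adding the four
    inequalities cancels all values of f and leaves a quadratic in t; no
    division by L - m occurs before t is chosen, so m = L is covered. *)
Lemma gradient_sector x y : 0 < L -> m <= L ->
  strongly_convex m f -> lipschitz_gradient L f ->
  0 <= dot (grad f x - grad f y - m *: (x - y))
           (L *: (x - y) - (grad f x - grad f y)).
Proof.
move=> L0 mL cf lip; have df := lip.1.
have [d dE] : exists d, d = x - y by eexists.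
have [h hE] : exists h, h = grad f x - grad f y - m *: d by eexists.
rewrite -dE -hE.
have -> : L *: d - (grad f x - grad f y) = (L - m) *: d - h.
  by rewrite hE scalerBl [- (_ - m *: d)]opprB addrA subrK.
have key t : 2 * t * dot h h - dot h d <= (L - m) * t ^+ 2 * dot h h.
  have c1 := strongly_convex_above_tangent (t *: h - d) (df x) cf.
  have s1 := descent_bound y (t *: h) L0 lip.
  have c2 := strongly_convex_above_tangent (d - t *: h) (df y) cf.
  have s2 := descent_bound x (- t *: h) L0 lip.
  have e1 : x + (t *: h - d) = y + t *: h.
    by rewrite dE opprB addrCA [x + (y - x)]addrC subrK addrC.
  have e2 : y + (d - t *: h) = x + - t *: h.
    by rewrite addrA [y + d]addrC dE subrK scaleNr.
  rewrite e1 in c1; rewrite e2 in c2.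
  have gh : dot (grad f x) h - dot (grad f y) h = dot h h + m * dot d h.
    have : dot h h = dot (grad f x - grad f y - m *: d) h by rewrite -hE.
    by rewrite [in RHS]dotDl [in RHS]dotDl !dotNl dotZl; lra.
  have gd : dot (grad f x) d - dot (grad f y) d = dot h d + m * dot d d.
    by rewrite hE !dotE; ring.
  clear e1 e2; move: c1 s1 c2 s2 gh gd.
  rewrite !dotE (dotC h d); nra.
rewrite !dotE; have := dot_ge0 h; set N := dot h h => N0.
have [N_eq0|N_neq0] := eqVneq N 0.
  by rewrite N_eq0 subr0 mulr_ge0 ?subr_ge0 //; have := key 0; lra.
(* For m = L the right-hand side of [key] vanishes: t = 1 makes h . d positive,
   and t = h . d / |h|^2 makes it nonpositive. *)
have [mLE|ltmL] := eqVneq m L.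
  have := key 1; have := key (dot h d / N); rewrite mLE -/N.
  rewrite -[2 * _ * _]mulrA divfK //.
  suff : 0 < N by lra.
  by rewrite lt_neqAle eq_sym N_neq0.
have Lm0 : 0 < L - m by rewrite subr_gt0 lt_neqAle ltmL.
(* This t maximizes 2 t - (L - m) t ^ 2. *)
have := key (L - m)^-1; rewrite -/N -(ler_pM2l Lm0).
have -> : (L - m) * (2 * (L - m)^-1 * N - dot h d) = 2 * N - (L - m) * dot h d.
  by field; rewrite gt_eqF.
have -> : (L - m) * ((L - m) * (L - m)^-1 ^+ 2 * N) = N.
  by field; rewrite gt_eqF.
lra.
Qed.

End SmoothConvex.

(** * Multipliers for the scalar inequality *)

Section Certificate.
Variable R : realType.
Implicit Types m L a r x g : R.

(** The quadratic form of the LMI with n = 1 and P = 1, together with the sign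
    condition on the multiplier: the S-procedure certificate that
    |x - a g| <= r |x| whenever g lies in the sector [m, L]. *)
Definition sector_certificate m L a r lam : Prop :=
  0 <= lam /\ forall x g : R,
    (x - a * g) ^+ 2 - r ^+ 2 * x ^+ 2 + 2 * lam * ((g - m * x) * (L * x - g)) <= 0.

Lemma sector_certificate_mono m L a r r' lam : 0 <= r -> r <= r' ->
  sector_certificate m L a r lam -> sector_certificate m L a r' lam.
Proof.
move=> r0 rr' [lam0 cert]; split=> // x g.
have : r ^+ 2 * x ^+ 2 <= r' ^+ 2 * x ^+ 2.
  by rewrite ler_wpM2r ?sqr_ge0 // ler_sqr // nnegrE // (le_trans r0).
have := cert x g; lra.
Qed.

(** Along g = s x the form is a quadratic in s.  For a <= 2 / (L + m) the worst
    slope is m and r = 1 - a m is enough; then s = m is a root, and lambda is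
    chosen to make it a double root, so that the form is minus a nonnegative
    multiple of (g - m x)^2.  For longer steps m and L exchange roles. *)
Lemma sector_certificate_sharp m L a r : 0 < m -> m < L -> 0 <= a ->
  `|1 - a * m| <= r -> `|1 - a * L| <= r ->
  exists lam, sector_certificate m L a r lam.
Proof.
move=> m0 mL a0 am aL; have Lm0 : 0 < L - m by lra.
have Lm : L - m != 0 by rewrite gt_eqF.
have [aE|aE] := leP (a * (L + m)) 2.
  exists (a * (1 - a * m) / (L - m)).
  have am1 : 0 <= 1 - a * m by nra.
  apply: (@sector_certificate_mono _ _ _ (1 - a * m)) => //.
    by rewrite -[X in X <= _]ger0_norm.
  split; first by apply: divr_ge0; [exact: mulr_ge0 | exact: ltW].
  move=> x g.
  have -> : (x - a * g) ^+ 2 - (1 - a * m) ^+ 2 * x ^+ 2 +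
     2 * (a * (1 - a * m) / (L - m)) * ((g - m * x) * (L * x - g)) =
     - (a * (2 - a * (L + m)) / (L - m) * (g - m * x) ^+ 2) by field.
  rewrite oppr_le0 mulr_ge0 ?sqr_ge0 //.
  by apply: divr_ge0; [rewrite mulr_ge0 // subr_ge0 | exact: ltW].
exists (a * (a * L - 1) / (L - m)).
have aL1 : 0 <= a * L - 1 by nra.
apply: (@sector_certificate_mono _ _ _ (a * L - 1)) => //.
  by rewrite -[X in X <= _]ger0_norm // distrC.
split; first by apply: divr_ge0; [exact: mulr_ge0 | exact: ltW].
move=> x g.
have -> : (x - a * g) ^+ 2 - (a * L - 1) ^+ 2 * x ^+ 2 +
   2 * (a * (a * L - 1) / (L - m)) * ((g - m * x) * (L * x - g)) =
   - (a * (a * (L + m) - 2) / (L - m) * (g - L * x) ^+ 2) by field.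
rewrite oppr_le0 mulr_ge0 ?sqr_ge0 //.
by apply: divr_ge0; [rewrite mulr_ge0 // subr_ge0 ltW | exact: ltW].
Qed.

(** For m = L, put u = g - L x and b = 1 - a L.  The form is
    (b x - a u)^2 - r^2 x^2 - 2 lambda u^2, and lambda is the smallest
    multiplier for which this is nonpositive: completing the square then leaves
    nothing but the term in D x + b a u, where D = r^2 - b^2 > 0. *)
Lemma sector_certificate_eq L a r : `|1 - a * L| < r ->
  exists lam, sector_certificate L L a r lam.
Proof.
move=> aL; have : (1 - a * L) ^+ 2 < r ^+ 2.
  by rewrite -[X in X < _]real_normK ?num_real // ltr_sqr // nnegrE ?normr_ge0 // ltW // (le_lt_trans _ aL).
rewrite -subr_gt0; set b := 1 - a * L => D0.
have [D DE] : exists D, D = r ^+ 2 - b ^+ 2 by eexists.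
rewrite -DE in D0; have rE : r ^+ 2 = D + b ^+ 2 by rewrite DE subrK.
have D1 : D != 0 by rewrite gt_eqF.
exists (a ^+ 2 * r ^+ 2 / (2 * D)); split.
  apply: divr_ge0; first by rewrite mulr_ge0 ?sqr_ge0.
  by rewrite mulr_ge0 // ltW.
move=> x g.
have -> : (x - a * g) ^+ 2 - r ^+ 2 * x ^+ 2 +
   2 * (a ^+ 2 * r ^+ 2 / (2 * D)) * ((g - L * x) * (L * x - g)) =
   - ((D * x + b * a * (g - L * x)) ^+ 2 / D).
  have -> : x - a * g = b * x - a * (g - L * x) by rewrite /b; ring.
  by rewrite rE; field.
by rewrite oppr_le0 divr_ge0 ?sqr_ge0 // ltW.
Qed.

(** With a = 1 / L the rate r = |1 - a L| = 0 is allowed: this is the borderline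
    case of the previous lemma in which the certificate survives, because b = 0
    removes the cross term x u. *)
Lemma sector_certificate_inverse_step L r : 0 < L ->
  exists lam, sector_certificate L L L^-1 r lam.
Proof.
move=> L0; exists (L^-1 ^+ 2 / 2); split; first by rewrite divr_ge0 ?sqr_ge0.
move=> x g.
have -> : (x - L^-1 * g) ^+ 2 - r ^+ 2 * x ^+ 2
   + 2 * (L^-1 ^+ 2 / 2) * ((g - L * x) * (L * x - g)) = - (r * x) ^+ 2.
  by field; rewrite gt_eqF.
by rewrite oppr_le0 sqr_ge0.
Qed.

End Certificate.

Lemma sector_certificate_dot (R : realType) (n : nat) (m L a r lam : R)
    (x g : 'cV[R]_n) : sector_certificate m L a r lam ->
  dot (x - a *: g) (x - a *: g) - r ^+ 2 * dot x x
    + 2 * lam * dot (g - m *: x) (L *: x - g) <= 0.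
Proof.
move=> [_ cert]; rewrite /dot !mulr_sumr -sumrB -big_split /=.
apply: sumr_le0 => i _; rewrite !mxE -!expr2; exact: cert.
Qed.

(** * The linear matrix inequality *)

Section RateLMI.
Variables (R : realType) (n : nat) (m L a r lam : R).
Implicit Types (P : 'M[R]_n) (x g : 'cV[R]_n).

Definition form P x (y : 'cV[R]_n) : R := (x^T *m P *m y) 0 0.

(** The LMI is the one-step decrease of x |-> x^T P x along x - a g at rate r^2,
    plus the multiplier times the sector product. *)
Lemma rate_lmi_form P x g : P^T = P ->
  ((col_mx x g)^T *m
   (block_mx ((1 - r ^+ 2) *: P) (- a *: P) (- a *: P) (a ^+ 2 *: P)
    + lam *: block_mx (- (2 * m * L))%:M (L + m)%:M (L + m)%:M (- 2)%:M)
   *m col_mx x g) 0 0 =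
  form P (x - a *: g) (x - a *: g) - r ^+ 2 * form P x x
    + 2 * lam * dot (g - m *: x) (L *: x - g).
Proof.
move=> Psym.
have dotM u v : (u^T *m v) 0 0 = dot u v :> R.
  by rewrite mxE; apply: eq_bigr => i _; rewrite mxE.
have formC : form P g x = form P x g.
  have -> : form P x g = (x^T *m P *m g)^T 0 0 by rewrite [RHS]mxE.
  by rewrite !trmx_mul trmxK Psym mulmxA.
have formE (k l : R) : (x^T *m (k *: P + lam *: l%:M)) = k *: (x^T *m P) + (lam * l) *: x^T.
  by rewrite mulmxDr -!scalemxAr mul_mx_scalar scalerA.
have formE' (k l : R) : (g^T *m (k *: P + lam *: l%:M)) = k *: (g^T *m P) + (lam * l) *: g^T.
  by rewrite mulmxDr -!scalemxAr mul_mx_scalar scalerA.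
rewrite tr_col_mx scale_block_mx add_block_mx mul_row_block mul_row_col.
rewrite !formE !formE' !mulmxDl -!scalemxAl.
have -> : form P (x - a *: g) (x - a *: g)
    = form P x x - 2 * a * form P x g + a ^+ 2 * form P g g.
  rewrite {1}/form !linearB /= linearZ /= !mulmxBl -!scalemxAl.
  rewrite -!scalemxAr.
  have mE (A B : 'M[R]_1) : (A - B) 0 0 = A 0 0 - B 0 0 by rewrite !mxE.
  have mZ (k : R) (A : 'M[R]_1) : (k *: A) 0 0 = k * A 0 0 by rewrite !mxE.
  rewrite !(mE, mZ) -!/(form _ _ _) formC; ring.
have mD (A B : 'M[R]_1) : (A + B) 0 0 = A 0 0 + B 0 0 by rewrite !mxE.
have mZ (k : R) (A : 'M[R]_1) : (k *: A) 0 0 = k * A 0 0 by rewrite !mxE.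
rewrite !(mD, mZ) !dotM -!/(form _ _ _) formC !dotE (dotC g x); ring.
Qed.

Lemma rate_lmi_certificate : sector_certificate m L a r lam ->
  rate_lmi m L a r (1%:M : 'M[R]_n) lam.
Proof.
move=> cert; split.
  have trZ k : (k *: (1%:M : 'M[R]_n))^T = k *: 1%:M.
    by rewrite linearZ /= tr_scalar_mx.
  rewrite linearD /= tr_block_mx !trZ; congr (_ + _).
  by rewrite linearZ /= tr_block_mx !tr_scalar_mx.
move=> x; rewrite -[x]vsubmxK rate_lmi_form ?tr_scalar_mx //.
have E u : form 1%:M u u = dot u u.
  by rewrite /form mulmx1 mxE; apply: eq_bigr => i _; rewrite mxE.
rewrite !E; exact: sector_certificate_dot.
Qed.

(** The LMI is tested on (x, s x), where the sector product
    (s - m) (L - s) |x|^2 is nonnegative and the rest is a multiple of x^T P x;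
    the nonzero vector x is arbitrary, and exists because n > 0. *)
Lemma rate_lmi_slope_le P s : (0 < n)%N -> 0 <= r -> m <= s <= L -> 0 <= lam ->
  positive_definite P -> rate_lmi m L a r P lam -> `|1 - a * s| <= r.
Proof.
move=> n0 r0 /andP[ms sL] lam0 [Psym Ppos] [_ neg].
pose x : 'cV[R]_n := const_mx 1.
have x0 : x != 0.
  apply/eqP => /matrixP /(_ (Ordinal n0) 0) /eqP.
  by rewrite !mxE oner_eq0.
have := neg (col_mx x (s *: x)); rewrite rate_lmi_form //.
rewrite -[s *: x - _]scalerBl -scalerBl dotE dotE.
have -> : x - a *: (s *: x) = (1 - a * s) *: x.
  by rewrite scalerBl scale1r scalerA.
have -> : form P ((1 - a * s) *: x) ((1 - a * s) *: x)
    = (1 - a * s) ^+ 2 * form P x x.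
  by rewrite /form -scalemxAr [_^T]linearZ /= -!scalemxAl scalerA -expr2 [LHS]mxE.
have sec : 0 <= 2 * lam * ((s - m) * ((L - s) * dot x x)).
  by rewrite !mulr_ge0 ?subr_ge0 ?dot_ge0.
have := Ppos x x0; rewrite -/(form P x x) => P0 le0.
have : (1 - a * s) ^+ 2 <= r ^+ 2.
  by rewrite -(ler_pM2r P0); lra.
rewrite -[X in X <= _]real_normK ?num_real //.
by rewrite ler_sqr // nnegrE.
Qed.

End RateLMI.

Lemma positive_definite1 (R : realType) (n : nat) :
  positive_definite (1%:M : 'M[R]_n).
Proof.
split=> [|x x0]; first exact: tr_scalar_mx.
have -> : (x^T *m 1%:M *m x) 0 0 = dot x x.
  by rewrite mulmx1 mxE; apply: eq_bigr => i _; rewrite mxE.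
by rewrite lt_neqAle dot_ge0 andbT eq_sym; apply: contra_neq x0; apply: dot_eq0.
Qed.

Lemma feasible_of_certificates (R : realType) (n : nat)
    (m L lo hi r lam_lo lam_hi : R) :
  0 <= r <= 1 -> sector_certificate m L lo r lam_lo ->
  sector_certificate m L hi r lam_hi -> feasible_rate n m L lo hi r.
Proof.
move=> r01 clo chi; split=> //; exists 1%:M, lam_lo, lam_hi.
split; [exact: positive_definite1 | exact: clo.1 | exact: chi.1 | |];
  exact: rate_lmi_certificate.
Qed.

(** * The worst contraction factor *)

Section RhoVarying.
Variable R : realType.
Implicit Types m L c a s : R.

Lemma rho_varying_max m L c : 0 < m -> m <= L -> 1 <= c -> c < 2 ->
  rho_varying (L / m) c = Num.max (c - 1) (1 - m / (c * L)).
Proof.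
move=> m0 mL c1 c2; have L0 : 0 < L by apply: lt_le_trans mL.
have c0 : 0 < c by apply: lt_le_trans c1.
have kE : (c * (L / m))^-1 = m / (c * L) by field; rewrite !gt_eqF.
have cc : 0 < c * (2 - c) by rewrite mulr_gt0 ?subr_gt0.
have E : (L / m <= (c * (2 - c))^-1) = (1 - m / (c * L) <= c - 1).
  rewrite ler_pdivrMr // mulrC ler_pdivlMr //.
  have -> : (1 - m / (c * L) <= c - 1) = (2 - c <= m / (c * L)).
    by apply/idP/idP; lra.
  rewrite ler_pdivlMr ?mulr_gt0 //; congr (_ <= _); ring.
by rewrite /rho_varying kE E maxC maxEle; case: ifP.
Qed.

Lemma rho_varying_ge0 m L c : 0 < m -> m <= L -> 1 <= c -> c < 2 ->
  0 <= rho_varying (L / m) c.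
Proof.
move=> m0 mL c1 c2; by rewrite rho_varying_max // le_max subr_ge0 c1.
Qed.

Lemma rho_varying_lt1 m L c : 0 < m -> m <= L -> 1 <= c -> c < 2 ->
  rho_varying (L / m) c < 1.
Proof.
move=> m0 mL c1 c2; have L0 : 0 < L by apply: lt_le_trans mL.
have cB1 : c - 1 < 1 by lra.
rewrite rho_varying_max // gt_max cB1 /=.
by rewrite gtrBl divr_gt0 // mulr_gt0 //; apply: lt_le_trans c1.
Qed.

(** From m / (c L) <= a s <= c, both 1 - a s and a s - 1 are bounded by one of
    the two terms of the maximum. *)
Lemma rho_varying_slope m L c a s : 0 < m -> m <= L -> 1 <= c -> c < 2 ->
  (c * L)^-1 <= a <= c / L -> m <= s <= L ->
  `|1 - a * s| <= rho_varying (L / m) c.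
Proof.
move=> m0 mL c1 c2 /andP[loa ahi] /andP[ms sL].
have L0 : 0 < L by apply: lt_le_trans mL.
have c0 : 0 < c by apply: lt_le_trans c1.
have lo0 : 0 < (c * L)^-1 by rewrite invr_gt0 mulr_gt0.
have up : a * s <= c.
  have -> : c = c / L * L by rewrite divfK // gt_eqF.
  by apply: ler_pM => //; [exact: ltW (lt_le_trans lo0 loa) | exact: ltW (lt_le_trans m0 ms)].
have dn : m / (c * L) <= a * s.
  by rewrite mulrC; apply: ler_pM => //; exact: ltW.
have lo : - (a * s - 1) <= 1 - m / (c * L) by lra.
have hi : a * s - 1 <= c - 1 by lra.
by rewrite rho_varying_max // distrC ler_norml lerNl !le_max lo hi orbT.
Qed.

End RhoVarying.

(** * The contraction and the optimal value *)

(** For m < L the certificate is added to the sector constraint of the gradient.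
    For m = L no certificate with the sharp rate need exist, but the sector
    constraint says |grad f x - L x|^2 <= 0, so the step is x |-> (1 - a L) x. *)
Lemma gradient_step_contracts (R : realType) (n : nat) (f : 'cV[R]_n -> R)
    (m L a r : R) (x : 'cV[R]_n) :
  0 < m -> m <= L -> 0 <= a -> `|1 - a * m| <= r -> `|1 - a * L| <= r ->
  strongly_convex m f -> lipschitz_gradient L f -> (forall y, f 0 <= f y) ->
  enorm (x - a *: grad f x) <= r * enorm x.
Proof.
move=> m0 mL a0 am aL cf lip min0; have L0 := lt_le_trans m0 mL.
have r0 : 0 <= r := le_trans (normr_ge0 _) am.
have := gradient_sector x 0 L0 mL cf lip.
rewrite (grad_minimizer L0 lip min0) !subr0 enorm_leE //.
set g := grad f x => sector.
have [mLE|neq_mL] := eqVneq m L.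
  have gE : g = L *: x.
    apply/eqP; rewrite -subr_eq0; apply/eqP/dot_eq0/le_anti.
    rewrite dot_ge0 andbT; move: sector; rewrite mLE.
    by rewrite -[L *: x - g]opprB dotNr oppr_ge0.
  have -> : x - a *: g = (1 - a * L) *: x.
    by rewrite gE scalerBl scale1r scalerA.
  rewrite !dotE mulrA -expr2 ler_wpM2r ?dot_ge0 //.
  by rewrite -[X in X <= _]real_normK ?num_real // ler_sqr // nnegrE.
have ltmL : m < L by rewrite lt_neqAle neq_mL.
have [lam cert] := sector_certificate_sharp m0 ltmL a0 am aL.
have := sector_certificate_dot x g cert.
by have : 0 <= 2 * lam * dot (g - m *: x) (L *: x - g);
  [rewrite !mulr_ge0 // cert.1 | lra].
Qed.

(** The point rho itself need not belong to F.  If the infimum i exceeded rho^2,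
    the square root of a number strictly between rho^2 and i would lie in F. *)
Lemma inf_sqr_ray (R : realType) (F : set R) (rho : R) : 0 <= rho -> rho < 1 ->
  (forall r, F r -> rho <= r) -> (forall r, rho < r <= 1 -> F r) ->
  inf [set r ^+ 2 | r in F] = rho ^+ 2.
Proof.
move=> rho0 rho1 lbF aboveF; set S := [set _ | _ in _].
have F1 : F 1 by apply: aboveF; rewrite rho1 lexx.
have lbS : lbound S (rho ^+ 2).
  move=> _ [r Fr <-]; have rhor := lbF _ Fr.
  by rewrite ler_sqr // nnegrE // (le_trans rho0).
apply/le_anti/andP; split; last first.
  by apply: lb_le_inf => //; exists (1 ^+ 2), 1.
rewrite leNgt; apply/negP => lt_inf.
have infS r : F r -> inf S <= r ^+ 2.
  by move=> Fr; apply: ge_inf; [exists (rho ^+ 2) | exists r].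
have inf1 := infS 1 F1; rewrite expr1n in inf1.
pose q := (rho ^+ 2 + inf S) / 2.
have q0 : 0 <= q by have := sqr_ge0 rho; rewrite /q; lra.
have rhoq : rho ^+ 2 < q by rewrite /q; lra.
have q1 : q <= 1 by rewrite /q; lra.
have : F (Num.sqrt q).
  apply: aboveF; rewrite -(@ltr_sqr _ rho) ?nnegrE ?sqrtr_ge0 // sqr_sqrtr //.
  by rewrite rhoq -sqrtr1 ler_wsqrtr.
by move=> /infS; rewrite sqr_sqrtr // /q; lra.
Qed.

Theorem proposition1 (R : realType) (n : nat) (m L c kappa alpha_lo alpha_hi : R)
    (n_gt0 : (0 < n)%N) (m_gt0 : 0 < m) (le_mL : m <= L)
    (kappaE : kappa = L / m) (c_ge1 : 1 <= c) (c_lt2 : c < 2)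
    (alpha_loE : alpha_lo = (c * L)^-1) (alpha_hiE : alpha_hi = c / L) :
  [/\ optimal_rate n m L alpha_lo alpha_hi (rho_varying kappa c),
      m < L \/ c = 1 ->
        feasible_rate n m L alpha_lo alpha_hi (rho_varying kappa c) &
      forall f : 'cV[R]_n -> R,
        strongly_convex m f -> lipschitz_gradient L f ->
        (forall x, f 0 <= f x) ->
        gd_convergence_rate f alpha_lo alpha_hi (rho_varying kappa c)].
Proof.
have L0 := lt_le_trans m_gt0 le_mL; have c0 := lt_le_trans ltr01 c_ge1.
rewrite kappaE; set rho := rho_varying _ _.
have rho0 : 0 <= rho by exact: rho_varying_ge0.
have rho1 : rho < 1 by exact: rho_varying_lt1.
have slope a s : alpha_lo <= a <= alpha_hi -> m <= s <= L -> `|1 - a * s| <= rho.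
  by rewrite alpha_loE alpha_hiE; exact: rho_varying_slope.
have lo0 : 0 < alpha_lo by rewrite alpha_loE invr_gt0 mulr_gt0.
have lohi : alpha_lo <= alpha_hi.
  rewrite alpha_loE alpha_hiE invfM ler_pM2r ?invr_gt0 //.
  by rewrite (le_trans _ c_ge1) // invf_le1.
have step_ge0 a : alpha_lo <= a <= alpha_hi -> 0 <= a.
  by case/andP => loa _; exact: ltW (lt_le_trans lo0 loa).
have lo_in : alpha_lo <= alpha_lo <= alpha_hi by rewrite lexx.
have hi_in : alpha_lo <= alpha_hi <= alpha_hi by rewrite lexx andbT.
have m_in : m <= m <= L by rewrite lexx.
have L_in : m <= L <= L by rewrite lexx andbT.
have cert_attained a : m < L \/ c = 1 -> alpha_lo <= a <= alpha_hi ->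
    exists lam, sector_certificate m L a rho lam.
  move=> mLc a_in; have [mLE|neq_mL] := eqVneq m L; last first.
    apply: sector_certificate_sharp; auto.
    by rewrite lt_neqAle neq_mL.
  case: mLc => [|c1]; first by rewrite mLE ltxx.
  (* For c = 1 the two step sizes coincide. *)
  have -> : a = L^-1.
    by apply/le_anti; move: a_in; rewrite alpha_loE alpha_hiE c1 !mul1r andbC.
  by rewrite mLE; exact: sector_certificate_inverse_step.
have cert_above a r : alpha_lo <= a <= alpha_hi -> rho < r ->
    exists lam, sector_certificate m L a r lam.
  move=> a_in rhor; have [mLE|neq_mL] := eqVneq m L.
    by rewrite mLE; apply: sector_certificate_eq; apply: le_lt_trans rhor; auto.
  have [|lam cert] := cert_attained a _ a_in; first by left; rewrite lt_neqAle neq_mL.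
  by exists lam; apply: sector_certificate_mono cert => //; exact: ltW.
have above r : rho < r <= 1 -> feasible_rate n m L alpha_lo alpha_hi r.
  case/andP=> rhor r1.
  have [lam_lo clo] := cert_above _ _ lo_in rhor.
  have [lam_hi chi] := cert_above _ _ hi_in rhor.
  apply: feasible_of_certificates clo chi.
  by rewrite r1 (le_trans rho0) // ltW.
have below r : feasible_rate n m L alpha_lo alpha_hi r -> rho <= r.
  case=> /andP[r0 r1] [P [lam_lo [lam_hi [Ppos lo_ge0 hi_ge0 lmi_lo lmi_hi]]]].
  have slo := rate_lmi_slope_le n_gt0 r0 m_in lo_ge0 Ppos lmi_lo.
  have shi := rate_lmi_slope_le n_gt0 r0 L_in hi_ge0 Ppos lmi_hi.
  rewrite /rho rho_varying_max // ge_max; apply/andP; split.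
    apply: le_trans shi; rewrite alpha_hiE divfK ?gt_eqF // distrC.
    exact: ler_norm.
  apply: le_trans slo; rewrite alpha_loE [_ * m]mulrC; exact: ler_norm.
split.
- split=> //; first by exists 1; apply: above; rewrite rho1 lexx.
  exact: inf_sqr_ray.
- have rho01 : 0 <= rho <= 1 by rewrite rho0 ltW.
  move=> mLc.
  have [lam_lo clo] := cert_attained _ mLc lo_in.
  have [lam_hi chi] := cert_attained _ mLc hi_in.
  exact: feasible_of_certificates clo chi.
- move=> f cf lip min0; exists 1 => // alpha x alpha_in gd k; rewrite mul1r.
  elim: k => [|k IHk]; first by rewrite expr0 mul1r.
  rewrite gd exprS -mulrA; apply: le_trans (ler_wpM2l rho0 IHk).
  by apply: (gradient_step_contracts (m := m) (L := L)) => //; auto.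
Qed.
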